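(* Let $a,b,c$ be positive reals with $a\neq b$, $m$ a positive integer, $k$ a nonnegative integer, $r$ a positive integer and $\overline{\alpha}_r=(\alpha_0,\dots,\alpha_{r-1})$ complex numbers. Then for all real $x$ and $n\in\mathbb{N}_0$, $$M^{[m-1,r]}_{n}(x;k;a,b,c;\overline{\alpha}_{r})=\sum_{j=0}^{\lfloor n/2\rfloor}\sum_{\ell=2j}^{n}2^{-\ell}\binom{n}{n-\ell}\binom{\ell}{2j}\frac{(2j)!}{j!}(\ln c)^{\ell}H_{\ell-2j}(x)M^{[m-1,r]}_{n-\ell}(k;a,b,c;\overline{\alpha}_{r}).$$
   Context: $H_p(x)$ denotes the Hermite polynomials, given by $e^{2xt-t^2}=\sum_{p\ge0}H_p(x)\frac{t^p}{p!}$. The polynomials $M^{[m-1,r]}_{n}(x;k;a,b,c;\overline{\alpha}_{r})$ are the Taylor coefficients at $t=0$ of $$\frac{t^{rkm}2^{rm(1-k)}c^{xt}}{\prod_{i=0}^{r-1}\left(\alpha_{i}b^{t}-a^{t}\sum_{p=0}^{m-1}\frac{t^{p}}{p!}\right)}=\sum_{n=0}^{\infty}M^{[m-1,r]}_{n}(x;k;a,b,c;\overline{\alpha}_{r})\frac{t^{n}}{n!},$$ the parameters being assumed such that this function is analytic near $t=0$; and $M^{[m-1,r]}_{n}(k;a,b,c;\overline{\alpha}_{r}):=M^{[m-1,r]}_{n}(0;k;a,b,c;\overline{\alpha}_{r})$. *)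

(* Defs.v *)
From Stdlib Require Import Reals ZArith List Epsilon.
From Coquelicot Require Import Coquelicot.

Open Scope R_scope.

(** Hermite polynomials: [hermite p x] is H_p(x), where
    e^(2xt-t^2) = sum_(p>=0) H_p(x) t^p/p! for all t.
    The sequence is unique (coefficients of a power series), so the choice made
    by [epsilon] is immaterial. *)
Definition is_hermite (x : R) (H : nat -> R) : Prop :=
  forall t : R,
    is_series (fun p : nat => H p * (t ^ p / INR (fact p)))
              (exp (2 * x * t - t ^ 2)).

Definition hermite (p : nat) (x : R) : R :=
  epsilon (inhabits (fun _ : nat => 0)) (is_hermite x) p.

Definition Cexp (z : C) : C :=
  (exp (Re z) * cos (Im z), exp (Re z) * sin (Im z)).

(** Principal power b^t = e^(t ln b); only meaningful for b > 0. *)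
Definition RCpower (b : R) (t : C) : C := Cexp (t * RtoC (ln b))%C.

(** [u] is the sequence of coefficients of t^n/n! in the Taylor expansion of [f]
    at 0.  The neighbourhood is punctured: for the functions below the formula
    is of the form 0/0 at t = 0 when some alpha_i = 1 and rkm > 0, and the
    singularity is removed by continuity, as for t/(e^t-1). *)
Definition is_taylor0 (f : C -> C) (u : nat -> C) : Prop :=
  @locally' C_UniformSpace (RtoC 0) (fun t : C =>
    @is_series C_AbsRing C_NormedModule
      (fun n : nat => u n * (t ^ n / RtoC (INR (fact n))))%C (f t)).

Definition analytic_near0 (f : C -> C) : Prop :=
  exists u : nat -> C, is_taylor0 f u.

(** Meaningful when [analytic_near0 f], and then independent of the choice made
    by [epsilon]. *)
Definition taylor0 (f : C -> C) : nat -> C :=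
  epsilon (inhabits (fun _ : nat => RtoC 0)) (is_taylor0 f).

(** alpha b^t - a^t sum_(p<m) t^p/p!  (for m > 0). *)
Definition M_factor (m : nat) (a b : R) (alpha t : C) : C :=
  (alpha * RCpower b t
   - RCpower a t
     * sum_n_m (fun p : nat => t ^ p / RtoC (INR (fact p)))%C 0 (m - 1))%C.

(** [alpha] is the tuple (alpha_0, ..., alpha_(r-1)), of length [r].
    For a, b > 0, a <> b and m > 0 no factor of the denominator vanishes
    identically, so near 0 the denominator is nonzero for t <> 0. *)
Definition M_gf (m r k : nat) (a b c : R) (alpha : list C) (x : R) (t : C) : C :=
  (t ^ (r * k * m)
   * RtoC (powerRZ 2 (Z.of_nat r * Z.of_nat m * (1 - Z.of_nat k)))
   * RCpower c (RtoC x * t)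
   / fold_right Cmult (RtoC 1) (map (fun al : C => M_factor m a b al t) alpha))%C.

Definition M_poly (m r k : nat) (a b c : R) (alpha : list C) (n : nat) (x : R) : C :=
  taylor0 (M_gf m r k a b c alpha x) n.

Definition M_num (m r k : nat) (a b c : R) (alpha : list C) (n : nat) : C :=
  M_poly m r k a b c alpha n 0.

(* Main.v *)
Require Import Defs.
From Stdlib Require Import Reals Arith List.
From Coquelicot Require Import Coquelicot.
From Stdlib Require Import Epsilon Lra Lia.

(** For real [t] the generating function at [x] is that at [0] times the real
    number [exp (x t ln c)], so all series manipulations can be done with real
    power series, on real and imaginary parts.  Uniqueness of coefficients gives
    M_n(x) = sum_l C(n,l) (x ln c)^l M_(n-l)(0), and the theorem follows by
    expanding (2x)^l / l! = sum_j H_(l-2j)(x) / ((l-2j)! j!), which is the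
    identity exp(2xt) = exp(t^2) exp(2xt-t^2). *)

(** * Real power series known on a punctured interval *)

Lemma CV_radius_ge (a : nat -> R) (r : R) :
  (forall t, 0 < Rabs t < r -> ex_pseries a t) -> Rbar_le r (CV_radius a).
Proof.
intros Ha.
destruct (Rbar_le_lt_dec r (CV_radius a)) as [Hle|Hlt]; [exact Hle|exfalso].
assert (H0 := CV_radius_ge_0 a).
destruct (CV_radius a) as [rho| |] eqn:Hrho; simpl in Hlt, H0; try easy.
assert (Ht : Rabs ((rho + r) / 2) = (rho + r) / 2) by (apply Rabs_pos_eq; lra).
(* The midpoint lies strictly between the radius [rho] and [r]: its terms cannot tend to 0, yet the
   series converges there. *)
apply (CV_disk_outside a ((rho + r) / 2)).
- rewrite Hrho, Ht; simpl; lra.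
- apply ex_series_lim_0.
  destruct (Ha ((rho + r) / 2)) as [l Hl]; [rewrite Ht; lra|].
  exists l; now apply is_pseries_R.
Qed.

(* The series are multiplied by [t] so that they also agree at [t = 0]. *)
Lemma pseries_coeff_unique (a b : nat -> R) (f : R -> R) (r : R) (n : nat) :
  0 < r ->
  (forall t, 0 < Rabs t < r -> is_pseries a t (f t)) ->
  (forall t, 0 < Rabs t < r -> is_pseries b t (f t)) ->
  a n = b n.
Proof.
intros Hr Ha Hb.
assert (Hpos : forall u : nat -> R,
  (forall t, 0 < Rabs t < r -> is_pseries u t (f t)) ->
  Rbar_lt 0 (CV_radius (PS_incr_1 u))).
{ intros u Hu; rewrite CV_radius_incr_1.
  apply Rbar_lt_le_trans with (Finite r); [exact Hr|].
  apply CV_radius_ge; intros t Ht; exists (f t); exact (Hu t Ht). }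
apply (PSeries_ext_recip (PS_incr_1 a) (PS_incr_1 b) (S n)); auto.
exists (mkposreal r Hr); intros t Ht.
rewrite !PSeries_incr_1.
destruct (Req_dec t 0) as [->|Ht0]; [ring|].
assert (Ht' : 0 < Rabs t < r).
{ split; [now apply Rabs_pos_lt|].
  unfold ball in Ht; simpl in Ht; unfold AbsRing_ball in Ht.
  unfold minus, plus, opp, abs in Ht; simpl in Ht.
  now rewrite Ropp_0, Rplus_0_r in Ht. }
now rewrite (is_pseries_unique _ _ _ (Ha t Ht')), (is_pseries_unique _ _ _ (Hb t Ht')).
Qed.

(** Convergence at all nonzero points of the interval forces both radii to be at least [r], so the
    Cauchy product is legitimate strictly inside. *)
Lemma is_pseries_mult_punctured (a b : nat -> R) (f g : R -> R) (r : R) :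
  (forall t, 0 < Rabs t < r -> is_pseries a t (f t)) ->
  (forall t, 0 < Rabs t < r -> is_pseries b t (g t)) ->
  forall t, 0 < Rabs t < r -> is_pseries (PS_mult a b) t (f t * g t).
Proof.
intros Ha Hb t Ht.
assert (Hlt : forall (u : nat -> R) (h : R -> R),
  (forall t, 0 < Rabs t < r -> is_pseries u t (h t)) ->
  Rbar_lt (Rabs t) (CV_radius u)).
{ intros u h Hu; apply Rbar_lt_le_trans with (Finite r); [apply Ht|].
  apply CV_radius_ge; intros s Hs; exists (h s); exact (Hu s Hs). }
apply is_pseries_mult; eauto.
Qed.

(** * Gaussian series and Hermite polynomials *)

Lemma is_pseries_exp_linear (s t : R) :
  is_pseries (fun n => s ^ n / INR (fact n)) t (exp (s * t)).
Proof.
apply is_pseries_R.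
generalize (proj1 (is_pseries_R _ _ _) (is_exp_Reals (s * t))).
apply is_series_ext; simpl; intros n; rewrite Rpow_mult_distr; unfold Rdiv; ring.
Qed.

(** Coefficient of [t ^ i] in [exp (s * t ^ 2)]. The value [s = -1] serves to construct the Hermite
    polynomials, [s = 1] to invert their generating function. *)
Definition exp_square_coeff (s : R) (i : nat) : R :=
  if Nat.even i then s ^ (i / 2) / INR (fact (i / 2)) else 0.

Lemma is_pseries_exp_square (s t : R) :
  is_pseries (exp_square_coeff s) t (exp (s * t ^ 2)).
Proof.
(* Even part plus [t] times odd part, the latter being the zero series. *)
replace (exp (s * t ^ 2)) with (exp (s * t ^ 2) + t * 0) by ring.
apply is_pseries_odd_even.
- generalize (is_pseries_exp_linear s (t ^ 2)).
  apply is_pseries_ext; intros n; unfold exp_square_coeff.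
  now rewrite Nat.even_even, (Nat.mul_comm 2 n), Nat.div_mul.
- apply is_pseries_R, (is_series_ext (fun _ => 0)).
  + intros n; unfold exp_square_coeff; rewrite Nat.even_odd.
    exact (eq_sym (Rmult_0_l _)).
  + apply (filterlim_ext (fun _ => 0)); [|apply filterlim_const].
    intros n; rewrite sum_n_const; ring.
Qed.

Lemma is_series_egf (u : nat -> R) (t l : R) :
  is_series (fun p => u p * (t ^ p / INR (fact p))) l <->
  is_pseries (fun p => u p / INR (fact p)) t l.
Proof.
rewrite is_pseries_R.
split; apply is_series_ext; simpl; intros n; unfold Rdiv; ring.
Qed.

(** The choice by [epsilon] is justified by exhibiting a sequence: the Cauchy product of the series
    of [exp (2 * x * t)] and [exp (- t ^ 2)], rescaled by factorials. *)
Lemma hermite_spec (x : R) : is_hermite x (fun p => hermite p x).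
Proof.
unfold hermite; apply (epsilon_spec (inhabits (fun _ : nat => 0)) (is_hermite x)).
set (h := PS_mult (fun n => (2 * x) ^ n / INR (fact n)) (exp_square_coeff (-1))).
exists (fun p => INR (fact p) * h p); intros t.
apply is_series_egf.
apply is_pseries_ext with h; [intros n; change (h n = INR (fact n) * h n / INR (fact n)); field; apply INR_fact_neq_0|].
(* The product lemma only covers [t <> 0]; at 0 every partial sum equals [h 0], which is 1. *)
destruct (Req_dec t 0) as [->|Ht].
- replace (exp (2 * x * 0 - 0 ^ 2)) with (h 0%nat).
  + apply is_pseries_R.
    apply (is_series_ext (fun n => h n * 0 ^ n)); [easy|].
    apply (filterlim_ext (fun _ => h 0%nat)); [|apply filterlim_const].
    intros n; induction n as [|n IH].
    * rewrite sum_O; simpl; ring.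
    * rewrite sum_Sn, <- IH; unfold plus; simpl; ring.
  + unfold h, PS_mult, exp_square_coeff; simpl.
    replace (2 * x * 0 - 0 * (0 * 1)) with 0 by ring; rewrite exp_0; field.
- replace (2 * x * t - t ^ 2) with (2 * x * t + -1 * t ^ 2) by ring.
  rewrite exp_plus.
  apply (is_pseries_mult_punctured _ _ (fun t => exp (2 * x * t))
    (fun t => exp (-1 * t ^ 2)) (Rabs t + 1)).
  + intros; apply is_pseries_exp_linear.
  + intros; apply is_pseries_exp_square.
  + split; [now apply Rabs_pos_lt|lra].
Qed.

Lemma pow_hermite_expansion (x : R) (l : nat) :
  (2 * x) ^ l / INR (fact l) =
  sum_n (fun i => exp_square_coeff 1 i
                  * (hermite (l - i) x / INR (fact (l - i)))) l.
Proof.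
rewrite sum_n_Reals.
change ((2 * x) ^ l / INR (fact l) =
  PS_mult (exp_square_coeff 1) (fun p => hermite p x / INR (fact p)) l).
apply (pseries_coeff_unique (fun l => (2 * x) ^ l / INR (fact l)) _
  (fun t => exp (2 * x * t)) 1); [lra|intros; apply is_pseries_exp_linear|].
intros t Ht.
replace (2 * x * t) with (1 * t ^ 2 + (2 * x * t - t ^ 2)) by ring.
rewrite exp_plus.
apply (is_pseries_mult_punctured _ _ (fun t => exp (1 * t ^ 2))
  (fun t => exp (2 * x * t - t ^ 2)) 1); [| |exact Ht].
- intros; apply is_pseries_exp_square.
- intros s _; apply is_series_egf, hermite_spec.
Qed.

(** By uniqueness, [v n / n!] is the Cauchy product of [s ^ l / l!] with [u p / p!]; multiplying by
    [n!] produces the binomials. *)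
Lemma egf_exp_mult (u v : nat -> R) (F : R -> R) (s r : R) (n : nat) :
  0 < r ->
  (forall t, 0 < Rabs t < r ->
     is_series (fun p => u p * (t ^ p / INR (fact p))) (F t)) ->
  (forall t, 0 < Rabs t < r ->
     is_series (fun p => v p * (t ^ p / INR (fact p))) (exp (s * t) * F t)) ->
  v n = sum_n (fun l => Binomial.C n (n - l) * s ^ l * u (n - l)%nat) n.
Proof.
intros Hr Hu Hv.
assert (E : v n / INR (fact n) =
  PS_mult (fun n => s ^ n / INR (fact n)) (fun n => u n / INR (fact n)) n).
{ apply (pseries_coeff_unique (fun n => v n / INR (fact n)) _
    (fun t => exp (s * t) * F t) r); [exact Hr| |].
  - intros t Ht; apply is_series_egf; auto.
  - apply is_pseries_mult_punctured.
    + intros; apply is_pseries_exp_linear.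
    + intros t Ht; apply is_series_egf; auto. }
assert (E' : v n = INR (fact n) * (v n / INR (fact n)))
  by (field; apply INR_fact_neq_0).
rewrite E', E; unfold PS_mult.
rewrite <- sum_n_Reals, <- (sum_n_mult_l (K := R_Ring)).
apply sum_n_ext_loc; intros l Hl; unfold Binomial.C, mult; simpl.
replace (n - (n - l))%nat with l by lia.
field; split; apply INR_fact_neq_0.
Qed.

(** * From complex Taylor series to real and imaginary parts *)

Lemma sum_n_pair (w : nat -> C) (n : nat) :
  @sum_n C_AbelianMonoid w n =
  (sum_n (fun l => fst (w l)) n, sum_n (fun l => snd (w l)) n).
Proof.
induction n as [|n IH].
- rewrite !sum_O; now destruct (w 0%nat).
- rewrite !sum_Sn, IH; reflexivity.
Qed.

Lemma is_series_fst_snd (a : nat -> C) (l : C) :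
  @is_series C_AbsRing C_NormedModule a l ->
  is_series (fun n => fst (a n)) (fst l) /\ is_series (fun n => snd (a n)) (snd l).
Proof.
intros Ha.
split.
- apply (filterlim_ext (fun n => fst (@sum_n C_AbelianMonoid a n))).
  { intros n; now rewrite sum_n_pair. }
  (* Continuity of the projection: a ball of [C] is a product of real balls, so the same [eps]
     works. *)
  intros P [eps HP].
  apply (Ha (fun z => P (fst z))).
  exists eps; intros z Hz; apply HP, Hz.
- apply (filterlim_ext (fun n => snd (@sum_n C_AbelianMonoid a n))).
  { intros n; now rewrite sum_n_pair. }
  intros P [eps HP].
  apply (Ha (fun z => P (snd z))).
  exists eps; intros z Hz; apply HP, Hz.
Qed.

(** On the real axis the weights [t ^ n / n!] are real, so the series splits into two real ones with
    coefficients [fst (u n)] and [snd (u n)]. *)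
Lemma is_taylor0_real (f : C -> C) (u : nat -> C) :
  is_taylor0 f u ->
  exists r, 0 < r /\ forall t, 0 < Rabs t < r ->
    is_series (fun n => fst (u n) * (t ^ n / INR (fact n))) (fst (f (RtoC t))) /\
    is_series (fun n => snd (u n) * (t ^ n / INR (fact n))) (snd (f (RtoC t))).
Proof.
intros [eps Heps].
exists eps; split; [apply cond_pos|]; intros t [Ht0 Ht].
assert (Hs : @is_series C_AbsRing C_NormedModule
  (fun n => u n * (RtoC t ^ n / RtoC (INR (fact n))))%C (f (RtoC t))).
{ apply Heps.
  - split; simpl; unfold ball; simpl; unfold AbsRing_ball;
      unfold minus, plus, opp, abs; simpl.
    + now rewrite Ropp_0, Rplus_0_r.
    + rewrite Ropp_0, Rplus_0_r, Rabs_R0; apply cond_pos.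
  - intros E; apply RtoC_inj in E; subst t; rewrite Rabs_R0 in Ht0; lra. }
apply is_series_fst_snd in Hs.
destruct Hs as [Hre Him].
assert (Hn : forall n, (RtoC t ^ n / RtoC (INR (fact n)))%C
                       = RtoC (t ^ n / INR (fact n))).
{ intros n; rewrite <- RtoC_pow, <- RtoC_div; [easy|apply INR_fact_neq_0]. }
split; [revert Hre|revert Him];
  apply is_series_ext; intros n; rewrite Hn; simpl; ring.
Qed.

(** * The addition formula in [x] *)

Lemma RCpower_real (c t : R) : RCpower c (RtoC t) = RtoC (exp (t * ln c)).
Proof.
unfold RCpower, Cexp; rewrite <- RtoC_mult; simpl.
now rewrite cos_0, sin_0, Rmult_1_r, Rmult_0_r.
Qed.

(** The variable [x] enters only through the power of [c]. The inverse of the denominator is treated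
    as an atom, so its vanishing is harmless. *)
Lemma M_gf_shift (m r k : nat) (a b c : R) (alpha : list C) (x t : R) :
  M_gf m r k a b c alpha x (RtoC t) =
  (RtoC (exp (x * ln c * t)) * M_gf m r k a b c alpha 0 (RtoC t))%C.
Proof.
unfold M_gf; rewrite <- !RtoC_mult, !RCpower_real.
rewrite Rmult_0_l, Rmult_0_l, exp_0.
replace (x * t * ln c) with (x * ln c * t) by ring.
unfold Cdiv; ring.
Qed.

Lemma M_poly_addition (m r k : nat) (a b c : R) (alpha : list C)
  (han : forall y : R, analytic_near0 (M_gf m r k a b c alpha y))
  (x : R) (n : nat) :
  M_poly m r k a b c alpha n x =
  @sum_n C_AbelianMonoid (fun l =>
    RtoC (Binomial.C n (n - l) * (x * ln c) ^ l)
    * M_num m r k a b c alpha (n - l))%C n.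
Proof.
(* Analyticity guarantees that [epsilon] returns a genuine Taylor sequence. *)
assert (Hspec : forall y, is_taylor0 (M_gf m r k a b c alpha y)
                            (fun n => M_poly m r k a b c alpha n y))
  by (intros y; exact (epsilon_spec _ _ (han y))).
destruct (is_taylor0_real _ _ (Hspec 0)) as (r0 & Hr0 & H0).
destruct (is_taylor0_real _ _ (Hspec x)) as (r1 & Hr1 & H1).
assert (Hr : 0 < Rmin r0 r1) by now apply Rmin_glb_lt.
assert (Hlt : forall t, 0 < Rabs t < Rmin r0 r1 ->
  0 < Rabs t < r0 /\ 0 < Rabs t < r1).
{ intros t Ht; generalize (Rmin_l r0 r1) (Rmin_r r0 r1); lra. }
rewrite sum_n_pair; apply injective_projections; simpl fst; simpl snd.
- rewrite (egf_exp_mult (fun n => fst (M_poly m r k a b c alpha n 0))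
    (fun n => fst (M_poly m r k a b c alpha n x))
    (fun t => fst (M_gf m r k a b c alpha 0 (RtoC t))) (x * ln c)
    (Rmin r0 r1) n Hr).
  + apply sum_n_ext; intros l; simpl; unfold M_num; ring.
  + intros t Ht; apply H0, Hlt, Ht.
  + intros t Ht.
    replace (exp (x * ln c * t) * _) with
      (fst (M_gf m r k a b c alpha x (RtoC t))).
    * apply H1, Hlt, Ht.
    * rewrite M_gf_shift; simpl; ring.
- rewrite (egf_exp_mult (fun n => snd (M_poly m r k a b c alpha n 0))
    (fun n => snd (M_poly m r k a b c alpha n x))
    (fun t => snd (M_gf m r k a b c alpha 0 (RtoC t))) (x * ln c)
    (Rmin r0 r1) n Hr).
  + apply sum_n_ext; intros l; simpl; unfold M_num; ring.
  + intros t Ht; apply H0, Hlt, Ht.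
  + intros t Ht.
    replace (exp (x * ln c * t) * _) with
      (snd (M_gf m r k a b c alpha x (RtoC t))).
    * apply H1, Hlt, Ht.
    * rewrite M_gf_shift; simpl; ring.
Qed.

(** * Reindexing of finite sums *)

Lemma sum_n_even {G : AbelianMonoid} (g : nat -> G) (n : nat) :
  sum_n (fun i => if Nat.even i then g (i / 2)%nat else zero) n =
  sum_n g (n / 2).
Proof.
assert (Hodd : forall j, Nat.even (S (2 * j)) = false)
  by (intros j; rewrite <- Nat.add_1_r; apply Nat.even_odd).
(* The bound [2 * (n / 2)] is [n] or [n - 1]; in the second case the missing term has odd index and
   is zero. *)
assert (H : sum_n (fun i => if Nat.even i then g (i / 2)%nat else zero) (2 * (n / 2))
            = sum_n g (n / 2)).
{ generalize (n / 2)%nat; clear n; induction n as [|n IH].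
  - now rewrite !sum_O.
  - replace (2 * S n)%nat with (S (S (2 * n))) by lia.
    rewrite !sum_Sn, IH.
    rewrite Hodd, plus_zero_r.
    replace (S (S (2 * n))) with (2 * S n)%nat by lia.
    rewrite Nat.even_even, (Nat.mul_comm 2 (S n)), Nat.div_mul by easy.
    reflexivity. }
assert (Hn := Nat.div_mod_eq n 2).
assert (Hlt := Nat.mod_upper_bound n 2 (Nat.neq_succ_0 1)).
destruct (n mod 2)%nat as [|[|]]; [| |lia].
- rewrite Hn, Nat.add_0_r at 1; exact H.
- rewrite Hn at 1; rewrite Nat.add_1_r, sum_Sn, H.
  rewrite Hodd, plus_zero_r; reflexivity.
Qed.

(** Induction on the size of the triangle: passing to [S n] adds one entry to each row [i <= n] and
    the corner [f (S n) (S n)], which together form the new column. *)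
Lemma sum_triangle_exchange {G : AbelianMonoid} (f : nat -> nat -> G) (n : nat) :
  sum_n (fun i => sum_n_m (f i) i n) n =
  sum_n (fun l => sum_n (fun i => f i l) l) n.
Proof.
induction n as [|n IH].
- rewrite !sum_O; apply sum_n_n.
- rewrite (sum_Sn (fun l => sum_n _ l)), <- IH, !sum_Sn, sum_n_n.
  rewrite (sum_n_ext_loc _
    (fun i => plus (sum_n_m (f i) i n) (f i (S n)))).
  + rewrite sum_n_plus; symmetry; apply plus_assoc.
  + intros i Hi; apply sum_n_Sm; lia.
Qed.

Lemma RtoC_sum_n (f : nat -> R) (n : nat) :
  RtoC (sum_n f n) = @sum_n C_AbelianMonoid (fun i => RtoC (f i)) n.
Proof.
induction n as [|n IH]; [now rewrite !sum_O|].
rewrite !sum_Sn, <- IH; exact (RtoC_plus _ _).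
Qed.

Theorem theorem4p5
  (a b c : R) (ha : (0 < a)%R) (hb : (0 < b)%R) (hc : (0 < c)%R) (hab : a <> b)
  (m k r : nat) (hm : (0 < m)%nat) (hr : (0 < r)%nat)
  (alpha : list C) (halpha : length alpha = r)
  (han : forall y : R, analytic_near0 (M_gf m r k a b c alpha y))
  (x : R) (n : nat) :
  M_poly m r k a b c alpha n x =
  sum_n_m (fun j : nat =>
    sum_n_m (fun l : nat =>
      RtoC (/ 2 ^ l * Binomial.C n (n - l) * Binomial.C l (2 * j)
            * (INR (fact (2 * j)) / INR (fact j))
            * ln c ^ l * hermite (l - 2 * j) x)%R
      * M_num m r k a b c alpha (n - l))%C
    (2 * j) n)
  0 (n / 2).
Proof.
(* The coefficient of [M (n - l)], with [i] standing for [2 * j]. It comes from writing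
   [(x * ln c) ^ l] as [(ln c / 2) ^ l * (2 * x) ^ l] and expanding the second power in Hermite
   polynomials. *)
set (A := fun i l => Binomial.C n (n - l) * (ln c / 2) ^ l * INR (fact l)
  * (exp_square_coeff 1 i * (hermite (l - i) x / INR (fact (l - i))))).
set (M := M_num m r k a b c alpha).
rewrite (M_poly_addition m r k a b c alpha han).
fold M.
transitivity (@sum_n C_AbelianMonoid
  (fun l => @sum_n C_AbelianMonoid (fun i => RtoC (A i l) * M (n - l)%nat)%C l) n).
{ apply sum_n_ext; intros l.
  rewrite (sum_n_mult_r (K := C_Ring) (M (n - l)%nat) (fun i => RtoC (A i l))).
  change (@mult C_Ring) with Cmult; f_equal.
  rewrite <- (RtoC_sum_n (fun i => A i l)); f_equal.
  unfold A; rewrite (sum_n_mult_l (K := R_Ring)), <- pow_hermite_expansion.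
  unfold mult; simpl.
  replace (x * ln c) with (ln c / 2 * (2 * x)) by field.
  rewrite Rpow_mult_distr; field; apply INR_fact_neq_0. }
rewrite <- (sum_triangle_exchange (G := C_AbelianMonoid)
  (fun i l => RtoC (A i l) * M (n - l)%nat)%C).
symmetry.
(* The sum over [j] becomes one over all [i <= n] that vanishes at odd [i], to be matched term by
   term with the triangle. *)
refine (eq_trans (eq_sym (sum_n_even _ n)) _).
apply sum_n_ext; intros i.
destruct (Nat.even i) eqn:Hi.
- apply Nat.even_spec in Hi; destruct Hi as [j ->].
  replace (2 * j / 2)%nat with j by (rewrite Nat.mul_comm, Nat.div_mul; easy).
  apply sum_n_m_ext_loc; intros l Hl; f_equal; f_equal.
  unfold A, exp_square_coeff.
  rewrite Nat.even_even, (Nat.mul_comm 2 j), Nat.div_mul, (Nat.mul_comm j 2) by easy.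
  (* Only [Binomial.C l (2 * j)] is opened: times [(2j)! / j!] it gives the [l! / ((l - 2j)! j!)]
     present in [A]. *)
  unfold Binomial.C at 2; rewrite pow1.
  replace ((ln c / 2) ^ l) with (/ 2 ^ l * ln c ^ l)
    by (unfold Rdiv; rewrite Rpow_mult_distr, pow_inv; ring).
  field; repeat split; try apply INR_fact_neq_0; apply pow_nonzero; lra.
- symmetry; rewrite (sum_n_m_ext _ (fun _ => @zero C_AbelianMonoid)).
  + apply sum_n_m_const_zero.
  + intros l; unfold A, exp_square_coeff; rewrite Hi, Rmult_0_l, Rmult_0_r.
    exact (Cmult_0_l _).
Qed.
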